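(* Let $d=(d_1,\dots,d_n)$ be a vector of positive integers and $\Delta=\{B_1,\dots,B_m\}$ a collection of subsets of $[n]$ with no containment relations among them. The matrix $A_{\Delta,d}$ is a graphical unimodular matrix and it represents the toric variety of the space of compatible conditionals; that is, with rows and columns identified with parameters and indeterminates as specified in the context, the monomial parameterization associated to $A_{\Delta,d}$ is $C^i_{j}=P_{j}\,U^i_{j_{B_i}}$, so the toric ideal of $A_{\Delta,d}$ is the compatibility ideal $I_\Delta$. Hence the compatibility ideal $I_\Delta$ is generated by the circuit binomials $f_c$, where $c$ runs over the induced circuits of the bipartite graph associated to $A_{\Delta,d}$.
   Context: Notation: $[k]=\{1,\dots,k\}$. For $j=(j_1,\dots,j_n)\in[d_1]\times\cdots\times[d_n]$ and $B=\{k_1<\cdots<k_s\}\subseteq[n]$ write $j_B=(j_{k_1},\dots,j_{k_s})$, and $D_B=\prod_{k\in B}d_k$. Compatibility ideal: let $R=\mathbb{R}[C^i_{j}: 1\le i\le m,\ j\in[d_1]\times\cdots\times[d_n]]$, a polynomial ring in $m d_1\cdots d_n$ indeterminates. The compatibility ideal $I_\Delta\subseteq R$ is the ideal of all polynomials vanishing on the set parameterized by $C^i_{j}=P_{j}\,U^i_{j_{B_i}}$, where the parameters $P_{j}$ ($j\in[d_1]\times\cdots\times[d_n]$) and $U^i_{b}$ ($i\in[m]$, $b\in\prod_{k\in B_i}[d_k]$) range over all real numbers. (This variety is what is called the toric variety of the space of compatible conditionals.) Toric ideal of a matrix: for a nonnegative integer matrix $A$ with entries $a_{ri}$, the associated monomial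 parameterization is $x_i=\prod_r t_r^{a_{ri}}$, and its toric ideal is $I_A=\langle x^u-x^v : u,v \text{ nonnegative integer vectors},\ Au=Av\rangle$. The matrix $A_{\Delta,d}$: it is a $0/1$ matrix of format $\left(d_1\cdots d_n+\sum_{i=1}^m D_{B_i}\right)\times m\,d_1\cdots d_n$. Columns are labeled by pairs $(i,j)$ with $i\in[m]$, $j\in[d_1]\times\cdots\times[d_n]$; column $(i,j)$ corresponds to the indeterminate $C^i_j$. Rows are labeled by pairs $(0,j)$ with $j\in[d_1]\times\cdots\times[d_n]$ (corresponding to the parameter $P_j$) and by pairs $(i,b)$ with $i\in[m]$, $b\in\prod_{k\in B_i}[d_k]$ (corresponding to the parameter $U^i_b$). The entry in column $(i,j)$ is $1$ in row $(0,j)$ and in row $(i,j_{B_i})$, and $0$ in all other rows. A graphical unimodular matrix is a matrix such that: all its entries are $0$ or $1$; each column has exactly two $1$'s; and there is a partition of the rows into two sets $U,V$ such that each column has exactly one nonzero entry in a row of $U$ and exactly one nonzero entry in a row of $V$. Such a matrix $A$ is the vertex-edge incidence matrix of a bipartite graph (vertices $=$ rows, edges $=$ columns), called the bipartite graph associated to $A$. An induced circuit of a graph is a circuit (simple closed cycle) that has no chord in the graph. If a circuit $c$ of the associated bipartite graph has successive edges $e_1,\dots,e_{2r}$ in cyclic order, its circuit binomial is $f_c=\prod_{t=1}^r x_{e_{2t-1}}-\prod_{t=1}^r x_{e_{2t}}$, where $x_e$ is the indeterminate $C^i_j$ corresponding to the edge (column) $e=(i,j)$ (well defined up to sign). *)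

(* Defs.v *)
From HB Require Import structures.
From mathcomp Require Import all_boot all_order all_algebra.
From mathcomp Require Import boolp classical_sets reals.
From mathcomp Require Import mpoly.

Set Implicit Arguments.
Unset Strict Implicit.
Unset Printing Implicit Defensive.

Import GRing.Theory.
Local Open Scope ring_scope.

Definition ideal_gen (S : comNzRingType) (G : set S) : set S :=
  [set f | exists (k : nat) (a g : 'I_k -> S),
     (forall t, G (g t)) /\ f = \sum_(t < k) a t * g t]%classic.

Section ToricIdeal.
Context {p q : nat}.
Implicit Type A : 'M[nat]_(p, q).

Definition monomial_param (R : comNzRingType) A (t : 'I_p -> R) (c : 'I_q) : R :=
  \prod_(r < p) t r ^+ A r c.

(* [u] and [v] are exponent vectors and ['X_[u]] is the monomial x^u. *)
Definition toric_ideal (R : comNzRingType) A : set {mpoly R[q]} :=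
  ideal_gen [set f | exists u v : 'X_{1..q},
    A *m (\col_c u c) = A *m (\col_c v c) /\ f = 'X_[u] - 'X_[v]]%classic.

Definition graphical_unimodular A : Prop :=
  [/\ forall r c, A r c = 0%N \/ A r c = 1%N,
      forall c, #|[set r | A r c == 1%N]| = 2%N
    & exists U V : {set 'I_p},
        [/\ U :|: V = [set: 'I_p], [disjoint U & V]
          & forall c, #|[set r in U | A r c != 0%N]| = 1%N
                   /\ #|[set r in V | A r c != 0%N]| = 1%N]].

(* The graph with incidence matrix A: vertices are the row indices, edges are
   the column indices, and the edge c joins the vertices in [ends A c]. *)
Definition ends A (c : 'I_q) : {set 'I_p} := [set r | A r c != 0%N].

(* The closed cycle v_0, e_0, v_1, ..., v_(k-1), e_(k-1), v_0, where e_t joins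
   v_t to its cyclic successor.  Since repeated columns of A would be parallel
   edges, a circuit is recorded by its edges and not only by its vertices. *)
Definition is_circuit A (k : nat) (v : 'I_k -> 'I_p) (e : 'I_k -> 'I_q) : Prop :=
  [/\ (1 < k)%N, injective v, injective e
    & forall t, ends A (e t) = [set v t; v (ordS t)]].

Definition is_chord A (k : nat) (v : 'I_k -> 'I_p) (e : 'I_k -> 'I_q)
    (c : 'I_q) : Prop :=
  (forall t, c != e t) /\ (forall r, r \in ends A c -> exists t, r = v t).

Definition is_induced_circuit A (k : nat) (v : 'I_k -> 'I_p)
    (e : 'I_k -> 'I_q) : Prop :=
  is_circuit A v e /\ ~ exists c, is_chord A v e c.

(* Edges are numbered from 0, so the first product runs over the first, third,
   ... edges.  Circuits of a bipartite graph have even length. *)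
Definition circuit_binomial (R : comNzRingType) (k : nat) (e : 'I_k -> 'I_q) :
    {mpoly R[q]} :=
  \prod_(t < k | ~~ odd t) 'X_(e t) - \prod_(t < k | odd t) 'X_(e t).

Definition induced_circuit_binomials (R : comNzRingType) A : set {mpoly R[q]} :=
  [set f | exists (k : nat) (v : 'I_k -> 'I_p) (e : 'I_k -> 'I_q),
     is_induced_circuit A v e /\ f = circuit_binomial R e]%classic.

End ToricIdeal.

Arguments toric_ideal {p q} R A.
Arguments circuit_binomial {q} R {k} e.
Arguments induced_circuit_binomials {p q} R A.

Section Compatibility.
Context {n m : nat}.
Variables (d : 'I_n -> nat) (B : 'I_m -> {set 'I_n}).

(* The set [d_1] x ... x [d_n], with entries numbered from 0. *)
Definition state : finType := {dffun forall k : 'I_n, 'I_(d k)}.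

Definition substate (S : {set 'I_n}) : finType :=
  {dffun forall k : {k : 'I_n | k \in S}, 'I_(d (val k))}.

Definition restrict (S : {set 'I_n}) (j : state) : substate S :=
  [ffun k : {k : 'I_n | k \in S} => j (val k)].

(* [(i, j)] labels the column C^i_j; [inl j] labels the row P_j and
   [inr (Tagged _ b)], with b in [substate (B i)], labels the row U^i_b. *)
Definition col_label : finType := ('I_m * state)%type.
Definition row_label : finType := (state + {i : 'I_m & substate (B i)})%type.

Definition prow (j : state) : row_label := inl j.
Definition urow (i : 'I_m) (b : substate (B i)) : row_label :=
  inr (Tagged (fun i => substate (B i)) b).

(* Labels are turned into matrix and variable indices by [enum_rank]. *)
Definition compat_matrix : 'M[nat]_(#|row_label|, #|col_label|) :=
  \matrix_(r, c)
    let: (i, j) := enum_val c in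
    nat_of_bool ((enum_val r == prow j)
                 || (enum_val r == urow (restrict (B i) j))).

Definition param_values (R : Type) (P : state -> R)
    (U : forall i : 'I_m, substate (B i) -> R) (r : 'I_#|row_label|) : R :=
  match enum_val r with
  | inl j => P j
  | inr b => U (tag b) (tagged b)
  end.

Definition compat_param (R : comNzRingType) (P : state -> R)
    (U : forall i : 'I_m, substate (B i) -> R) (c : 'I_#|col_label|) : R :=
  let: (i, j) := enum_val c in P j * U i (restrict (B i) j).

Definition compat_ideal (R : comNzRingType) : set {mpoly R[#|col_label|]} :=
  [set f | forall (P : state -> R) (U : forall i : 'I_m, substate (B i) -> R),
     f.@[compat_param P U] = 0]%classic.

End Compatibility.

Arguments compat_ideal {n m} d B R.

(* Main.v *)
(* A polynomial vanishing on the image of a monomial parameterization is, by the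
   substitution t_r = y^(K^r) with K large, a combination of binomials x^u - x^v
   with A u = A v; so the compatibility ideal is toric.  Such a binomial is reduced
   by induction on its degree.  A common variable is divided out.  Otherwise u and v
   alternate along some circuit c of the bipartite graph, and x^u - x^v is a
   combination of f_c and a binomial of smaller degree.  If c has a chord, the chord
   splits it into two shorter circuits and f_c is a combination of their binomials;
   if not, f_c is one of the generators. *)
Require Import Defs.
From mathcomp Require Import all_boot all_order all_algebra.
From mathcomp Require Import boolp classical_sets reals.
From mathcomp Require Import mpoly.
From mathcomp Require Import zify ring.

(** * Closure properties of generated ideals *)

Section IdealGen.
Set Implicit Arguments.
Unset Strict Implicit.
Import GRing.Theory.
Local Open Scope ring_scope.
Context {S : comNzRingType}.
Implicit Types (G : set S) (f g : S).

Lemma ideal_gen_sub G f : G f -> ideal_gen G f.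
Proof.
move=> Gf; exists 1%N, (fun=> 1), (fun=> f); split=> //.
by rewrite big_ord1 mul1r.
Qed.

Lemma ideal_gen0 G : ideal_gen G 0.
Proof. by exists 0%N, (fun=> 0), (fun=> 0); rewrite big_ord0; split=> // -[]. Qed.

Lemma ideal_genD G f g : ideal_gen G f -> ideal_gen G g -> ideal_gen G (f + g).
Proof.
move=> [k [a [x [Gx ->]]]] [l [b [y [Gy ->]]]].
exists (k + l)%N, (fun t => match split t with inl i => a i | inr i => b i end),
  (fun t => match split t with inl i => x i | inr i => y i end).
split=> [t|]; first by case: (split t).
rewrite big_split_ord /=; congr (_ + _); apply: eq_bigr => i _.
  by rewrite (unsplitK (inl i : 'I_k + 'I_l)).
by rewrite (unsplitK (inr i : 'I_k + 'I_l)).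
Qed.

Lemma ideal_genM G f g : ideal_gen G g -> ideal_gen G (f * g).
Proof.
move=> [k [a [x [Gx ->]]]]; exists k, (fun t => f * a t), x; split=> //.
by rewrite big_distrr; apply: eq_bigr => t _; rewrite /= mulrA.
Qed.

Lemma ideal_genN G f : ideal_gen G f -> ideal_gen G (- f).
Proof. by move=> Gf; rewrite -mulN1r; apply: ideal_genM. Qed.

Lemma ideal_gen_sum G (I : Type) (r : seq I) (P : pred I) (F : I -> S) :
  (forall i, P i -> ideal_gen G (F i)) -> ideal_gen G (\sum_(i <- r | P i) F i).
Proof.
by move=> GF; apply: big_ind => //; [exact: ideal_gen0 | exact: ideal_genD].
Qed.

Lemma ideal_gen_min G G' f :
  (forall g, G g -> ideal_gen G' g) -> ideal_gen G f -> ideal_gen G' f.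
Proof.
move=> GG' [k [a [x [Gx ->]]]]; apply: ideal_gen_sum => i _.
exact/ideal_genM/GG'.
Qed.

End IdealGen.

(** * The toric ideal as the vanishing ideal of the monomial parameterization *)

Section ToricIdealVanishing.
Set Implicit Arguments.
Unset Strict Implicit.
Import GRing.Theory Num.Theory.
Local Open Scope ring_scope.

(** The entry of A u in row [r], that is, the exponent of t_r in the image of x^u. As a function of
    [r] it is the multidegree of x^u, so equal multidegrees are compared by [=1]. *)
Definition wdeg {p q : nat} (A : 'M[nat]_(p, q)) (u : 'X_{1..q}) (r : 'I_p) : nat :=
  (\sum_(c < q) A r c * u c)%N.

Context {p q : nat}.
Implicit Types (A : 'M[nat]_(p, q)) (u v w : 'X_{1..q}).

Lemma wdegP A u v :
  A *m (\col_c u c) = A *m (\col_c v c) <-> wdeg A u =1 wdeg A v.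
Proof.
have E w r : (A *m (\col_c w c)) r 0 = wdeg A w r.
  by rewrite mxE; apply: eq_bigr => c _; rewrite mxE.
split=> [eq_uv r|eq_uv]; first by rewrite -!E eq_uv.
by apply/matrixP => r j; rewrite ord1 !E.
Qed.

Lemma wdegD A u v r : wdeg A (u + v)%MM r = (wdeg A u r + wdeg A v r)%N.
Proof. by rewrite -big_split; apply: eq_bigr => c _; rewrite mnmDE mulnDr. Qed.

Lemma wdegU A c r : wdeg A U_(c)%MM r = A r c.
Proof.
rewrite /wdeg (bigD1 c) //= mnm1E eqxx muln1 big1 ?addn0 // => c' ne.
by rewrite mnm1E eq_sym (negbTE ne) muln0.
Qed.

Lemma wdeg_sum A (I : Type) (s : seq I) (P : pred I) (F : I -> 'X_{1..q}) r :
  wdeg A (\sum_(i <- s | P i) F i)%MM r = (\sum_(i <- s | P i) wdeg A (F i) r)%N.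
Proof.
apply: (big_morph (fun u => wdeg A u r)) => [u v|]; first exact: wdegD.
by rewrite /wdeg big1 // => c _; rewrite mnm0E muln0.
Qed.

Lemma meval_monomial_param (R : comNzRingType) A (t : 'I_p -> R) u :
  'X_[u].@[monomial_param A t] = \prod_(r < p) t r ^+ wdeg A u r.
Proof.
rewrite mevalX /monomial_param.
under eq_bigr => c _ do rewrite -prodrXl.
rewrite exchange_big; apply: eq_bigr => r _ /=.
by rewrite -prodrXr; apply: eq_bigr => c _; rewrite exprM.
Qed.

Lemma toric_ideal_vanish (R : comNzRingType) A (f : {mpoly R[q]}) :
  toric_ideal R A f -> forall t, f.@[monomial_param A t] = 0.
Proof.
move=> [k [a [g [Gg ->]]]] t; rewrite raddf_sum /= big1 // => i _.
have [u [v [/wdegP Auv ->]]] := Gg i.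
rewrite mevalM mevalB !meval_monomial_param.
by under eq_bigr => r _ do rewrite Auv; rewrite subrr mulr0.
Qed.

(** Uniqueness of digits in base [K]: reduction modulo [K] gives the lowest digit, and after
    cancelling it and dividing by [K] induction gives the others. *)
Lemma sum_base_inj (K l : nat) (x y : 'I_l -> nat) :
  (forall i, x i < K)%N -> (forall i, y i < K)%N ->
  (\sum_(i < l) x i * K ^ i = \sum_(i < l) y i * K ^ i)%N -> x =1 y.
Proof.
elim: l x y => [|l IH] x y xK yK; first by move=> _ [].
rewrite !big_ord_recl /= !expn0 !muln1.
have E (z : 'I_l.+1 -> nat) : (\sum_(i < l) z (lift ord0 i) * K ^ bump 0 i
    = (\sum_(i < l) z (lift ord0 i) * K ^ i) * K)%N.
  by rewrite big_distrl; apply: eq_bigr => i _; rewrite /= expnS; ring.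
rewrite !E => eq_xy.
have K_gt0 : (0 < K)%N by apply: leq_ltn_trans (xK ord0).
have x0y0 : x ord0 = y ord0.
  have := congr1 (modn^~ K) eq_xy.
  by rewrite ![(_ + _ * K)%N]addnC !modnMDl !modn_small.
move: eq_xy; rewrite x0y0 => /addnI/eqP; rewrite eqn_pmul2r // => /eqP eq_xy i.
have := IH _ _ (fun i => xK (lift ord0 i)) (fun i => yK (lift ord0 i)) eq_xy.
by case: (unliftP ord0 i) => [j|] -> // ->.
Qed.

(* Kronecker substitution [t_r = y ^ (K ^ r)]: for K large, distinct multidegrees
   become distinct exponents of y. *)
Lemma vanish_toric_ideal (R : numDomainType) A (f : {mpoly R[q]}) :
  (forall t, f.@[monomial_param A t] = 0) -> toric_ideal R A f.
Proof.
move=> f0; pose K := (\max_(u <- msupp f) \max_(r < p) wdeg A u r).+1.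
have ltK u r : u \in msupp f -> (wdeg A u r < K)%N.
  move=> uf; rewrite ltnS (leq_trans _ (leq_bigmax_seq _ uf _)) //.
  exact: leq_bigmax.
(* Since [K] exceeds every exponent that occurs, the multidegree of [u] is the digit string of [M u]
   in base [K], and [g] below is the image of [f] in the single variable y. *)
pose M u := (\sum_(r < p) wdeg A u r * K ^ r)%N.
have M_inj u v : u \in msupp f -> v \in msupp f -> M u = M v ->
    wdeg A u =1 wdeg A v.
  by move=> uf vf; apply: sum_base_inj => r; apply: ltK.
pose g : {poly R} := \sum_(u <- msupp f) f@_u *: 'X^(M u).
have g0 : g = 0.
  (* Every value of y is a root of [g]. The images of the first [size g] natural numbers are
     distinct in characteristic zero, and these are too many roots for a nonzero [g]. *)
  pose rs : seq R := [seq i%:R | i <- iota 0 (size g)].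
  apply: (@roots_geq_poly_eq0 _ g rs); last by rewrite size_map size_iota.
    apply/allP => y _; apply/eqP; rewrite -[RHS](f0 (fun r => y ^+ (K ^ r))).
    rewrite [in RHS](mpolyE f) raddf_sum /= horner_sum; apply: eq_bigr => u _.
    rewrite hornerZ hornerXn mevalZ meval_monomial_param; congr (_ * _).
    by rewrite /M -prodrXr; apply: eq_bigr => r _; rewrite -exprM mulnC.
  by rewrite map_inj_uniq ?iota_uniq //; apply: mulrIn; apply: oner_neq0.
(* One fixed monomial of [f] for each exponent [i] of y that occurs; the default [0%MM] is returned
   only for exponents that do not occur. *)
pose rep i := nth 0%MM (msupp f) (find (fun u => M u == i) (msupp f)).
have repP u : u \in msupp f -> rep (M u) \in msupp f /\ M (rep (M u)) = M u.
  move=> uf; have hasM : has (fun v => M v == M u) (msupp f).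
    by apply/hasP; exists u.
  by split; [apply: mem_nth; rewrite -has_find | apply/eqP/(nth_find _ hasM)].
pose N := (\max_(u <- msupp f) M u).+1.
(* The coefficient of y^i in [g] is the sum of the [f@_u] with [M u = i], so grouping the terms by
   [i] turns [g = 0] into this identity. *)
have rep0 : \sum_(u <- msupp f) f@_u *: 'X_[rep (M u)] = 0 :> {mpoly R[q]}.
  transitivity (\sum_(i < N) g`_i *: 'X_[rep i] : {mpoly R[q]}); last first.
    by rewrite big1 // => i _; rewrite g0 coef0 scale0r.
  under [RHS]eq_bigr => i _ do rewrite coef_sum scaler_suml.
  rewrite exchange_big /= !big_seq; apply: eq_bigr => u uf.
  have MN : (M u < N)%N by rewrite ltnS; apply: leq_bigmax_seq.
  rewrite (bigD1 (Ordinal MN)) //= coefZ coefXn eqxx mulr1 big1 ?addr0 // => i.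
  rewrite -val_eqE /= => /negbTE ne.
  by rewrite coefZ coefXn ne mulr0 scale0r.
(* Subtracting the sum in [rep0] leaves [f] unchanged and makes each term a multiple of a binomial
   whose two monomials have equal multidegree. *)
have -> : f = \sum_(u <- msupp f) (f@_u *: 'X_[u] - f@_u *: 'X_[rep (M u)]).
  by rewrite sumrB rep0 subr0 -mpolyE.
rewrite big_seq.
apply: ideal_gen_sum => u uf; rewrite -scalerBr -mul_mpolyC.
apply/ideal_genM/ideal_gen_sub; exists u, (rep (M u)); split=> //.
have [repf Mrep] := repP u uf.
by apply/wdegP/M_inj.
Qed.

Lemma toric_idealP (R : numDomainType) A (f : {mpoly R[q]}) :
  toric_ideal R A f <-> forall t, f.@[monomial_param A t] = 0.
Proof.
by split; [apply: toric_ideal_vanish | apply: vanish_toric_ideal].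
Qed.

End ToricIdealVanishing.

(** * Circuits of a bipartite graph in which edge c joins [a c] in [W] to [b c] outside [W] *)

Section BipartiteGraph.
Set Implicit Arguments.
Unset Strict Implicit.
Import GRing.Theory.
Local Open Scope ring_scope.

Context {p q : nat} (A : 'M[nat]_(p, q)) (a b : 'I_q -> 'I_p) (W : {set 'I_p}).
Hypothesis AE : forall r c, A r c = (r == a c) || (r == b c) :> nat.
Hypothesis aW : forall c, a c \in W.
Hypothesis bW : forall c, b c \notin W.

Lemma neq_ab c c' : (a c == b c') = false.
Proof. by apply: contraTF (aW c) => /eqP ->; apply: bW. Qed.

Lemma incE r c : A r c = ((r == a c) + (r == b c))%N.
Proof.
by rewrite AE; case: (eqVneq r (a c)) => // ->; rewrite neq_ab.
Qed.

Lemma endsE c : ends A c = [set a c; b c].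
Proof. by apply/setP => r; rewrite !inE AE eqb0 negbK. Qed.

Lemma bipartite_graphical_unimodular : graphical_unimodular A.
Proof.
split=> [r c|c|]; first by rewrite AE; case: orb; [right | left].
  transitivity #|[set a c; b c]|; last by rewrite cards2 neq_ab.
  by apply: eq_card => r; rewrite !inE AE eqb1.
exists W, (~: W); split=> [||c]; first exact: finset.setUCr.
  by rewrite finset.disjoints_subset finset.setCK.
split.
  rewrite -(cards1 (a c)); apply: eq_card => r; rewrite !inE AE eqb0 negbK.
  case: eqVneq => [->|_]; rewrite ?aW //=.
  by case: eqP => [->|]; rewrite ?andbF // (negbTE (bW c)).
rewrite -(cards1 (b c)); apply: eq_card => r; rewrite !inE AE eqb0 negbK.
case: (eqVneq r (b c)) => [->|_]; rewrite ?bW ?orbT // orbF.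
by case: eqP => [->|]; rewrite ?andbF // aW.
Qed.

(** Consecutive vertices are distinct, because [v] is injective and the length exceeds 1, so they
    are the two ends of [e t], one on each side. *)
Lemma circuit_sides k (v : 'I_k -> 'I_p) (e : 'I_k -> 'I_q) t :
  is_circuit A v e -> (v (ordS t) \in W) = (v t \notin W).
Proof.
move=> [k_gt1 v_inj _ /(_ t) eE].
have: v (ordS t) != v t.
  rewrite (inj_eq v_inj) -val_eqE /=.
  have := ltn_ord t; rewrite leq_eqVlt => /orP[/eqP tk|tk].
    by rewrite tk modnn; apply/eqP; lia.
  by rewrite modn_small //; apply/eqP; lia.
have vt : v t \in ends A (e t) by rewrite eE !inE eqxx.
have vs : v (ordS t) \in ends A (e t) by rewrite eE !inE eqxx orbT.
move: vt vs; rewrite endsE !inE.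
by move=> /orP[]/eqP-> /orP[]/eqP->; rewrite ?eqxx // ?(negbTE (bW _)) ?aW.
Qed.

(** Sides alternate along the circuit, and the step from the last vertex back to the first must
    change sides too. *)
Lemma circuit_even k (v : 'I_k -> 'I_p) (e : 'I_k -> 'I_q) :
  is_circuit A v e -> ~~ odd k.
Proof.
move=> vec; have [k_gt1 _ _ _] := vec; case: k => // k in v e vec k_gt1 *.
have side i (ik : (i < k.+1)%N) :
    (v (Ordinal ik) \in W) = (v ord0 \in W) (+) odd i.
  elim: i ik => [|i IH] ik.
    by rewrite addbF; congr (v _ \in W); apply: val_inj.
  have -> : Ordinal ik = ordS (Ordinal (ltnW ik)).
    by apply: val_inj; rewrite /= modn_small.
  by rewrite (circuit_sides _ vec) IH /= addbN.
have := circuit_sides ord_max vec.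
have -> : ordS ord_max = ord0 :> 'I_k.+1 by apply: val_inj; rewrite /= modnn.
have -> : ord_max = Ordinal (ltnSn k) by apply: val_inj.
by rewrite side /= negbK; case: (v ord0 \in W); case: (odd k).
Qed.

(** Edges of one parity form a perfect matching of the circuit: their first ends are the vertices of
    that parity, and their second ends are those of the other, because [ordS] flips parity on a
    cycle of even length. The result does not depend on [s], so both monomials of the circuit
    binomial have the same multidegree. *)
Lemma circuit_half_wdeg k (v : 'I_k -> 'I_p) (e : 'I_k -> 'I_q) (s : bool) r :
  is_circuit A v e ->
  wdeg A (\sum_(t < k | odd t == s) U_(e t))%MM r = (\sum_(t < k) (r == v t))%N.
Proof.
move=> vec; rewrite wdeg_sum.
have odd_ordS (t : 'I_k) : odd (ordS t) = ~~ odd t.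
  by rewrite /= odd_mod //; apply/negbTE/(circuit_even vec).
have v_ordS t : v (ordS t) != v t.
  apply/eqP => vt; have := circuit_sides t vec.
  by rewrite vt; case: (_ \in W).
have wE t : wdeg A U_(e t)%MM r = ((r == v t) + (r == v (ordS t)))%N.
  rewrite wdegU; have [_ _ _ /(_ t) eE] := vec.
  have -> : A r (e t) = (r \in ends A (e t)) :> nat by rewrite endsE AE !inE.
  rewrite eE !inE; case: (eqVneq r (v t)) => // ->.
  by rewrite eq_sym (negbTE (v_ordS t)).
under eq_bigr => t _ do rewrite wE.
rewrite big_split /= [RHS](bigID (fun t : 'I_k => odd t == s)) /=; congr addn.
rewrite [RHS](reindex_inj (@ordS_inj k)) /=.
by apply: eq_bigl => t; rewrite odd_ordS; case: (odd t) s => [] [].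
Qed.

Lemma circuit_binomial_toric (R : comNzRingType) k (v : 'I_k -> 'I_p)
    (e : 'I_k -> 'I_q) :
  is_circuit A v e -> toric_ideal R A (circuit_binomial R e).
Proof.
move=> vec; apply: ideal_gen_sub.
exists (\sum_(t < k | odd t == false) U_(e t))%MM,
  (\sum_(t < k | odd t == true) U_(e t))%MM; split.
  by apply/wdegP => r; rewrite !(circuit_half_wdeg _ _ vec).
rewrite /circuit_binomial -!mprodXE.
by congr (_ - _); apply: eq_bigl => t; case: (odd t).
Qed.

(* The edges f_0, h_0, f_1, h_1, ..., f_(s-1), h_(s-1) in cyclic order, where
   h_t joins the side-b end of f_t to the side-a end of f_(t+1). *)
Record alternating_cycle (s : nat) (f h : nat -> 'I_q) : Prop := {
  alt_gt0 : (0 < s)%N;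
  alt_b : forall t, b (h t) = b (f t);
  alt_a : forall t, a (h t) = a (f t.+1);
  alt_closed : a (f s) = a (f 0%N);
  alt_inj_a : {in gtn s &, injective (a \o f)};
  alt_inj_b : {in gtn s &, injective (b \o f)} }.

(** * Finding an alternating cycle inside a binomial *)

Lemma wdeg_gt0 u r : (0 < wdeg A u r)%N ->
  exists2 c, (0 < u c)%N & (r == a c) || (r == b c).
Proof.
rewrite lt0n sum_nat_eq0 negb_forall => /existsP[c].
by rewrite /= muln_eq0 AE eqb0 negb_or negbK -lt0n => /andP[? ?]; exists c.
Qed.

Lemma wdeg_gt0_end (u : 'X_{1..q}) r c :
  (0 < u c)%N -> (r == a c) || (r == b c) -> (0 < wdeg A u r)%N.
Proof.
move=> uc rc; rewrite lt0n sum_nat_eq0 negb_forall; apply/existsP; exists c.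
by rewrite /= muln_eq0 AE rc -lt0n uc.
Qed.

(* Follow an edge of u from side a to side b and then an edge of v back, always
   choosing the same edge at a given vertex: this deterministic walk runs into
   a cycle, whose vertices are distinct. *)
Lemma exists_alternating_cycle (u v : 'X_{1..q}) c0 :
  wdeg A u =1 wdeg A v -> (0 < u c0)%N ->
  exists (s : nat) (f h : nat -> 'I_q),
    [/\ alternating_cycle s f h, forall t, (0 < u (f t))%N
      & forall t, (0 < v (h t))%N].
Proof.
move=> Auv uc0.
pose F r := odflt c0 [pick c | (0 < u c)%N && (r == a c)].
pose H r := odflt c0 [pick c | (0 < v c)%N && (r == b c)].
pose phi r := a (H (b (F r))).
pose live r := (r \in W) && (0 < wdeg A u r)%N.
have liveF r : live r -> (0 < u (F r))%N /\ a (F r) = r.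
  move=> /andP[rW /wdeg_gt0[c uc rc]]; rewrite /F.
  case: pickP => [c' /andP[uc' /eqP ->] //|/(_ c)].
  rewrite uc; case/orP: rc => [-> //|/eqP rc].
  by rewrite rc (negbTE (bW c)) in rW.
have liveH r : live r -> (0 < v (H (b (F r))))%N /\ b (H (b (F r))) = b (F r).
  move=> /liveF[uF _]; set r' := b (F r).
  have: (0 < wdeg A v r')%N by rewrite -Auv (wdeg_gt0_end uF) // eqxx orbT.
  case/wdeg_gt0 => c vc rc; rewrite /H.
  case: pickP => [c' /andP[vc' /eqP ->] //|/(_ c)].
  by rewrite vc; case/orP: rc => [|-> //]; rewrite eq_sym neq_ab.
have live_phi r : live r -> live (phi r).
  move=> /liveH[vH _]; rewrite /live aW Auv.
  by rewrite (wdeg_gt0_end vH) // eqxx.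
pose x t := iter t phi (a c0).
have live_x t : live (x t).
  elim: t => [|t]; last exact: live_phi.
  by rewrite /live aW (wdeg_gt0_end uc0) // eqxx.
(* After as many steps as the orbit has points, the walk is back at some earlier point [x i]. The
   tail before [i] is dropped, which leaves a cycle of length [n - i]. *)
have /loopingP/(_ (order phi (a c0)))/trajectP[i i_lt xi] := looping_order phi (a c0).
set n := order phi (a c0) in i_lt xi.
have x_inj : {in gtn n &, injective x}.
  move=> t t' tn t'n /eqP; rewrite /x -(nth_traject phi tn) -(nth_traject phi t'n).
  by rewrite (nth_uniq _ _ _ (orbit_uniq phi (a c0))) ?size_traject // => /eqP.
pose f t := F (x (i + t)%N); pose h t := H (b (f t)).
have af t : a (f t) = x (i + t)%N by have [_ ->] := liveF _ (live_x (i + t)%N).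
have ah t : a (h t) = a (f t.+1) by rewrite af addnS.
have closed : a (f (n - i)%N) = a (f 0%N) by rewrite !af addn0 subnKC // ltnW.
have inj_a : {in gtn (n - i)%N &, injective (a \o f)}.
  move=> t t'; rewrite !inE => t_lt t'_lt /=; rewrite !af => /x_inj.
  by rewrite !inE => eq; apply/(@addnI i)/eq; lia.
exists (n - i)%N, f, h; split; last 2 first.
- by move=> t; have [] := liveF _ (live_x (i + t)%N).
- by move=> t; have [] := liveH _ (live_x (i + t)%N).
split=> // [|t|]; first by rewrite subn_gt0.
  by have [] := liveH _ (live_x (i + t)%N).
move=> t t'; rewrite !inE => t_lt t'_lt /= eq_b.
(* Equal b-ends have the same successor, since the walk is deterministic. Injectivity on side a then
   applies once the indices are reduced modulo the period. *)
have eq_a : a (f t.+1) = a (f t'.+1) by rewrite -!ah /h eq_b.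
have aS k : (k < n - i)%N -> a (f k.+1) = a (f (k.+1 %% (n - i))%N).
  by rewrite leq_eqVlt => /orP[/eqP ->|k_lt]; rewrite ?modnn ?modn_small.
have := inj_a (t.+1 %% (n - i))%N (t'.+1 %% (n - i))%N.
rewrite !inE !ltn_mod subn_gt0 i_lt /= -!aS // => /(_ isT isT eq_a)/eqP.
rewrite -(addn1 t) -(addn1 t') eqn_modDr !modn_small //.
by move/eqP.
Qed.

(** * The circuit of an alternating cycle, its binomial and its chords *)

Section Cycle.
Variables (s : nat) (f h : nat -> 'I_q).
Hypothesis cyc : alternating_cycle s f h.

Lemma alt_inj_f : {in gtn s &, injective f}.
Proof. by move=> t t' ts t's eq_f; apply: (alt_inj_a cyc) => //=; rewrite eq_f. Qed.

Lemma alt_inj_h : {in gtn s &, injective h}.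
Proof.
move=> t t' ts t's eq_h; apply: (alt_inj_b cyc) => //=.
by rewrite -!(alt_b cyc) eq_h.
Qed.

(** The contributions telescope: [h t] shares its b-end with [f t] and its a-end with [f t.+1], so
    only the two extreme vertices of the stretch, both on side a, remain. *)
Lemma alt_wdeg x y r : (x <= y)%N ->
  (wdeg A (\sum_(x <= t < y) U_(f t))%MM r + (r == a (f y)) =
   wdeg A (\sum_(x <= t < y) U_(h t))%MM r + (r == a (f x)))%N.
Proof.
elim: y => [|y IH]; first by rewrite leqn0 => /eqP ->; rewrite !big_geq.
rewrite leq_eqVlt => /orP[/eqP <-|]; first by rewrite !big_geq.
rewrite ltnS => xy; rewrite !big_nat_recr //= !wdegD !wdegU !incE.
by have := IH xy; rewrite (alt_b cyc) (alt_a cyc); lia.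
Qed.

Lemma alt_wdeg_closed :
  wdeg A (\sum_(0 <= t < s) U_(f t))%MM =1 wdeg A (\sum_(0 <= t < s) U_(h t))%MM.
Proof.
by move=> r; have := alt_wdeg r (leq0n s); rewrite (alt_closed cyc) => /addIn.
Qed.

(** Position 2t of the circuit carries a(f_t) and the edge f_t, position 2t+1 carries b(f_t) and the
    edge h_t; this is the order required by [is_circuit]. *)
Definition alt_vertex (t : 'I_s.*2) := if odd t then b (f t./2) else a (f t./2).
Definition alt_edge (t : 'I_s.*2) := if odd t then h t./2 else f t./2.

Lemma half_lt (t : 'I_s.*2) : (t./2 < s)%N.
Proof. by have := ltn_ord t; lia. Qed.

Lemma half_inj (t t' : 'I_s.*2) : odd t = odd t' -> t./2 = t'./2 -> t = t'.
Proof.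
move=> eq_odd eq_half; apply: val_inj.
by rewrite /= -[LHS]odd_double_half -[RHS]odd_double_half eq_odd eq_half.
Qed.

Lemma alt_circuit :
  (forall t t', (t < s)%N -> (t' < s)%N -> f t <> h t') ->
  is_circuit A alt_vertex alt_edge.
Proof.
move=> fh; split.
- by have := alt_gt0 cyc; lia.
- move=> t t'; rewrite /alt_vertex.
  case: ifP => ot; case: ifP => ot' /eqP; rewrite ?neq_ab // 1?eq_sym ?neq_ab //.
    move/eqP/esym => eq_b; apply: half_inj; first by rewrite ot ot'.
    by apply: (alt_inj_b cyc) => //; rewrite inE half_lt.
  move/eqP/esym => eq_a; apply: half_inj; first by rewrite ot ot'.
  by apply: (alt_inj_a cyc) => //; rewrite inE half_lt.
- move=> t t'; rewrite /alt_edge.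
  case: ifP => ot; case: ifP => ot' eq_e.
  + by apply: half_inj; [rewrite ot ot' | apply: alt_inj_h; rewrite ?inE ?half_lt].
  + by case: (fh _ _ (half_lt t') (half_lt t)).
  + by case: (fh _ _ (half_lt t) (half_lt t')).
  + by apply: half_inj; [rewrite ot ot' | apply: alt_inj_f; rewrite ?inE ?half_lt].
move=> t; rewrite endsE /alt_edge /alt_vertex /=.
have t_lt := ltn_ord t.
have [ot|ot] := boolP (odd t); last first.
  have tS : (t.+1 < s.*2)%N by lia.
  rewrite modn_small //= ot /=; congr [set _; b (f _)]; lia.
rewrite finset.setUC (alt_b cyc) (alt_a cyc); congr [set _; _].
have [tS|tS] := ltnP t.+1 s.*2.
  by rewrite modn_small //= ot /=; congr (a (f _)); lia.
(* The last edge is [h] at s-1, and the circuit closes up through a(f_s) = a(f_0). *)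
have -> : t.+1 = s.*2 by lia.
rewrite modnn /= -(alt_closed cyc); congr (a (f _)); lia.
Qed.

(** Each index below [s] is the half of exactly one even and one odd position. *)
Lemma big_alt (T : Type) (idx : T) (op : Monoid.law idx) (G : nat -> T) o :
  \big[op/idx]_(t < s.*2 | odd t == o) G t./2 = \big[op/idx]_(0 <= t < s) G t.
Proof.
rewrite -(big_mkord (fun t => odd t == o) (fun t => G t./2)) big_mkcond.
elim: s => [|n IH]; first by rewrite !big_geq.
rewrite doubleS !big_nat_recr //= IH odd_double uphalf_double doubleK.
by case: o {IH}; rewrite /= !Monoid.simpm.
Qed.

Lemma alt_circuit_binomial (R : comNzRingType) :
  circuit_binomial R alt_edge =
    'X_[(\sum_(0 <= t < s) U_(f t))%MM] - 'X_[(\sum_(0 <= t < s) U_(h t))%MM].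
Proof.
rewrite /circuit_binomial -!mprodXE -(big_alt _ _ false) -(big_alt _ _ true).
congr (_ - _); apply: eq_big => t; rewrite ?eqbF_neg ?eqb_id // /alt_edge.
  by move/negbTE->.
by move->.
Qed.

(** The chord [g] cuts the cycle into two closed pieces, each containing [g]. The pieces enter only
    as binomials of degree below [s] with equal multidegrees, which is what the degree induction
    supplies. *)
Lemma chord_split (R : comNzRingType) (G : set {mpoly R[q]}) g x y :
  (forall c c', a c = a c' -> b c = b c' -> c = c') ->
  (forall u v : 'X_{1..q}, (mdeg u < s)%N -> wdeg A u =1 wdeg A v ->
    ideal_gen G ('X_[u] - 'X_[v])) ->
  (x < s)%N -> (y < s)%N -> a g = a (f x) -> b g = b (f y) ->
  (forall t, (t < s)%N -> g <> f t /\ g <> h t) ->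
  ideal_gen G ('X_[(\sum_(0 <= t < s) U_(f t))%MM]
               - 'X_[(\sum_(0 <= t < s) U_(h t))%MM]).
Proof.
move=> simple IH xs ys ag bg gN.
have g_inc r : wdeg A U_(g)%MM r = ((r == a (f x)) + (r == b (f y)))%N.
  by rewrite wdegU incE ag bg.
(* P and H are the two halves of the stretch cut off by the chord, F' and H' those of the rest. In
   the identity below the two terms containing x_g cancel. *)
have combine (P F' H H' : 'X_{1..q}) :
    ideal_gen G ('X_[P] - 'X_[H + U_(g)]) ->
    ideal_gen G ('X_[H'] - 'X_[F' + U_(g)]) ->
    ideal_gen G ('X_[F' + P] - 'X_[H' + H]).
  move=> J1 J2.
  have -> : 'X_[F' + P] - 'X_[H' + H] = 'X_[F'] * ('X_[P] - 'X_[H + U_(g)])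
      - 'X_[H] * ('X_[H'] - 'X_[F' + U_(g)]) :> {mpoly R[q]}.
    by rewrite !mpolyXD; ring.
  by apply: ideal_genD; [|apply: ideal_genN]; apply: ideal_genM.
have split_at (F : nat -> 'X_{1..q}) i j : (i <= j)%N -> (j <= s)%N ->
    (\sum_(0 <= t < s) F t = (\sum_(0 <= t < i) F t + \sum_(j <= t < s) F t)
       + \sum_(i <= t < j) F t)%MM.
  move=> ij js; rewrite (big_cat_nat (n := j)) //=.
  rewrite [X in (X + _)%MM = _](big_cat_nat (n := i)) //=.
  by apply/mnmP => c; rewrite !mnmDE; lia.
have mdeg_path (F : nat -> 'I_q) i j : mdeg (\sum_(i <= t < j) U_(F t))%MM = (j - i)%N.
  rewrite mdeg_sum (eq_bigr (fun=> 1%N)) => [|t _]; last exact: mdeg1.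
  by rewrite sum_nat_const_nat muln1.
have [xy|yx] := leqP x y.
  have x_lt_y : (x < y)%N.
    rewrite ltn_neqAle xy andbT; apply/eqP => eq_xy.
    by have [gf _] := gN _ xs; apply/gf/simple; rewrite ?ag // eq_xy bg.
  (* A stretch of full length would mean x = 0 and y = s-1; then [g] would have the ends of h_(s-1),
     hence equal it. *)
  have P_short : (y.+1 - x < s)%N.
    rewrite ltn_neqAle leq_subLR (leq_trans ys) ?leq_addl // andbT.
    apply/eqP => eq_s; have x0 : x = 0%N by lia.
    have sy : y.+1 = s by lia.
    have [_ gh] := gN _ ys; apply/gh/simple; last by rewrite bg (alt_b cyc).
    by rewrite ag x0 (alt_a cyc) sy (alt_closed cyc).
  rewrite (split_at _ x y.+1) ?leqW // [X in _ - 'X_[X]](split_at _ x y) ?(ltnW ys) //.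
  (* The stretch from a(f_x) to a(f_y), prolonged by f_y to b(f_y), is closed by the chord. The
     other piece balances by subtraction from the whole cycle. *)
  have wP : wdeg A (\sum_(x <= t < y.+1) U_(f t)) =1
      wdeg A (\sum_(x <= t < y) U_(h t) + U_(g)).
    move=> r; rewrite big_nat_recr //= !wdegD wdegU incE g_inc.
    by have := alt_wdeg r xy; lia.
  apply: combine; apply: IH => //; rewrite ?mdegD ?mdeg_path //; first by lia.
  move=> r; have := alt_wdeg_closed r; have := wP r.
  rewrite (split_at _ x y.+1) ?leqW // [in X in _ -> _ = X -> _](split_at _ x y) ?(ltnW ys) //.
  by rewrite !wdegD; lia.
(* With y before x, the stretch cut off begins and ends with an [h] edge, so [f] and [h] exchange
   roles. The case y+1 = x is excluded because [g] would be h_y. *)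
have yx1 : (y.+1 < x)%N.
  rewrite ltn_neqAle yx andbT; apply/eqP => eq_xy.
  have [_ gh] := gN _ ys; apply/gh/simple; last by rewrite bg (alt_b cyc).
  by rewrite ag (alt_a cyc) eq_xy.
have wP : wdeg A (\sum_(y <= t < x) U_(h t)) =1
    wdeg A (\sum_(y.+1 <= t < x) U_(f t) + U_(g)).
  move=> r; have := alt_wdeg r (ltnW yx).
  by rewrite (big_ltn yx) /= !wdegD wdegU incE g_inc; lia.
rewrite -opprB; apply: ideal_genN.
rewrite (split_at _ y x) ?(ltnW yx) ?(ltnW xs) //.
rewrite [X in _ - 'X_[X]](split_at _ y.+1 x) ?(ltnW xs) //.
apply: combine; apply: IH => //; rewrite ?mdegD ?mdeg_path; [lia | lia |].
move=> r; have := alt_wdeg_closed r; have := wP r.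
rewrite (split_at _ y.+1 x) ?(ltnW xs) //.
rewrite [in X in _ -> _ = X -> _](split_at _ y x) ?(ltnW yx) ?(ltnW xs) //.
by rewrite !wdegD; lia.
Qed.

Lemma alt_chord c :
  is_chord A alt_vertex alt_edge c ->
  [/\ exists2 x, (x < s)%N & a c = a (f x), exists2 y, (y < s)%N & b c = b (f y)
    & forall t, (t < s)%N -> c <> f t /\ c <> h t].
Proof.
move=> [c_ne c_v]; split.
- have [|t] := c_v (a c); first by rewrite endsE !inE eqxx.
  rewrite /alt_vertex; case: ifP => _ => [/eqP|ac]; first by rewrite neq_ab.
  by exists t./2; first exact: half_lt.
- have [|t] := c_v (b c); first by rewrite endsE !inE eqxx orbT.
  rewrite /alt_vertex; case: ifP => _ => [bc|/esym/eqP]; last by rewrite neq_ab.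
  by exists t./2; first exact: half_lt.
move=> t ts; have t2 : (t.*2 < s.*2)%N by lia.
have t2S : (t.*2.+1 < s.*2)%N by lia.
have := c_ne (Ordinal t2); have := c_ne (Ordinal t2S).
by rewrite /alt_edge /= odd_double /= uphalf_double doubleK => /eqP ? /eqP.
Qed.

End Cycle.

(** * Reduction of toric binomials to induced circuits *)

Lemma sum_mnm1_le (u : 'X_{1..q}) s (f : nat -> 'I_q) :
  {in gtn s &, injective f} -> (forall t, (0 < u (f t))%N) ->
  (\sum_(0 <= t < s) U_(f t) <= u)%MM.
Proof.
move=> f_inj uf; apply/mnm_lepP => c; rewrite mnm_sumE big_mkord.
under eq_bigr => t _ do rewrite mnm1E.
(* By injectivity at most one [t] has f_t = c, so the exponent of [c] in the sum is 0 or 1. *)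
have [/existsP[t /eqP ft]|/existsPn fN] := boolP [exists t : 'I_s, f t == c].
  rewrite (bigD1 t) //= ft eqxx big1 ?addn0; first by rewrite -ft.
  move=> t' ne; case: eqP => // ft'; case/eqP: ne; apply: val_inj.
  by apply: f_inj; rewrite ?inE ?ltn_ord // ft ft'.
by rewrite big1 // => t _; rewrite (negbTE (fN t)).
Qed.

Lemma toric_binomial_induced_circuits (R : comNzRingType) (u v : 'X_{1..q}) :
  (forall c c', a c = a c' -> b c = b c' -> c = c') ->
  wdeg A u =1 wdeg A v ->
  ideal_gen (induced_circuit_binomials R A) ('X_[u] - 'X_[v]).
Proof.
move=> simple; have [N] := ubnP (mdeg u); elim: N u v => // N IH u v uN Auv.
have [/existsP[c /andP[uc vc]]|/existsPn uv0] :=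
    boolP [exists c, (0 < u c)%N && (0 < v c)%N].
  have le1 (w : 'X_{1..q}) : (0 < w c)%N -> (U_(c) <= w)%MM.
    move=> wc; apply/mnm_lepP => c'; rewrite mnm1E.
    by case: eqP => // <-.
  move: uN Auv; rewrite -(submK (le1 _ uc)) -(submK (le1 _ vc)).
  move: (u - _)%MM (v - _)%MM => u' v'; rewrite mdegD mdeg1 => u'N Auv.
  rewrite !mpolyXD -mulrBl mulrC; apply/ideal_genM/IH; first by lia.
  by move=> r; have := Auv r; rewrite !wdegD => /addIn.
(* If u = 0, then v has multidegree 0, and v = 0 because every column of [A] has a nonzero entry. *)
have [u0|/existsP[c0 uc0]] := boolP [forall c, u c == 0%N].
  suff -> : v = u by rewrite subrr; apply: ideal_gen0.
  have wu0 r : wdeg A u r = 0%N.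
    by apply: big1 => c _; rewrite (eqP (forallP u0 c)) muln0.
  apply/mnmP => c; rewrite (eqP (forallP u0 c)); apply/eqP; rewrite -leqn0 leqNgt.
  by apply/negP => /(@wdeg_gt0_end v (a c)); rewrite eqxx -Auv wu0 => /(_ isT).
rewrite -lt0n in uc0; have [s [f [h [cyc uf vh]]]] := exists_alternating_cycle Auv uc0.
have fu := sum_mnm1_le (alt_inj_f cyc) uf.
have hv := sum_mnm1_le (alt_inj_h cyc) vh.
have fh t t' : f t <> h t'.
  by move=> eq_fh; have := uv0 (f t); rewrite uf eq_fh vh.
have cyc_wdeg := alt_wdeg_closed cyc.
(* This bound brings the pieces produced by a chord, of degree below [s], within reach of the
   induction on the degree of [u]. *)
have s_le : (s <= mdeg u)%N.
  rewrite -(submK fu) mdegD mdeg_sum (eq_bigr (fun=> 1%N)) => [|t _].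
    by rewrite sum_nat_const_nat muln1 subn0 leq_addl.
  exact: mdeg1.
have Jcyc : ideal_gen (induced_circuit_binomials R A)
    ('X_[\sum_(0 <= t < s) U_(f t)] - 'X_[\sum_(0 <= t < s) U_(h t)]).
  have [[c /alt_chord[[x xs ac] [y ys bc] cN]]|no_chord] :=
      pselect (exists c, is_chord A (alt_vertex f (s := s)) (alt_edge f h (s := s)) c).
    apply: (chord_split cyc simple _ xs ys ac bc cN) => u' v' u's; apply: IH.
    by lia.
  apply: ideal_gen_sub; exists s.*2, (alt_vertex f (s := s)), (alt_edge f h (s := s)).
  split; last by rewrite alt_circuit_binomial.
  by split=> //; apply: alt_circuit.
move: uN Auv s_le; rewrite -(submK fu) -(submK hv).
set cf := (\sum_(0 <= t < s) U_(f t))%MM in cyc_wdeg Jcyc *.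
set ch := (\sum_(0 <= t < s) U_(h t))%MM in cyc_wdeg Jcyc *.
have cf_gt0 : (0 < mdeg cf)%N.
  rewrite mdeg_sum (eq_bigr (fun=> 1%N)) => [|t _]; last exact: mdeg1.
  by rewrite sum_nat_const_nat muln1 subn0 (alt_gt0 cyc).
move: (u - _)%MM (v - _)%MM => u' v' uN Auv _.
(* The first term is a multiple of the cycle binomial. In the second the degree has dropped because
   [cf] is not constant, and multidegrees still agree because those of [cf] and [ch] do. *)
have -> : 'X_[u' + cf] - 'X_[v' + ch] = 'X_[u'] * ('X_[cf] - 'X_[ch])
    + 'X_[ch] * ('X_[u'] - 'X_[v']) :> {mpoly R[q]} by rewrite !mpolyXD; ring.
apply: ideal_genD; apply: ideal_genM => //; apply: IH.
  by rewrite mdegD in uN; lia.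
by move=> r; have := Auv r; rewrite !wdegD cyc_wdeg => /addIn.
Qed.

Lemma toric_ideal_induced_circuits (R : comNzRingType) :
  (forall c c', a c = a c' -> b c = b c' -> c = c') ->
  toric_ideal R A = ideal_gen (induced_circuit_binomials R A).
Proof.
move=> simple; apply/seteqP; split=> f /=; apply: ideal_gen_min => g.
  by move=> [u [v [/wdegP Auv ->]]]; apply: toric_binomial_induced_circuits.
by move=> [k [v [e [[vec _] ->]]]]; apply: circuit_binomial_toric vec.
Qed.

End BipartiteGraph.

(** * The graph of the compatibility matrix and its parameterization *)

Section CompatMatrix.
Set Implicit Arguments.
Unset Strict Implicit.
Import GRing.Theory.
Local Open Scope ring_scope.

Context {n m : nat} (d : 'I_n -> nat) (B : 'I_m -> {set 'I_n}).

(** The two ends of the edge C^i_j, namely P_j and U^i_b with b the restriction of j to B_i. With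
    [compat_prows] they take the roles of [a], [b] and [W] above. *)
Definition compat_pend (c : 'I_#|@col_label n m d|) : 'I_#|row_label d B| :=
  enum_rank (prow B (enum_val c).2).

Definition compat_uend (c : 'I_#|@col_label n m d|) : 'I_#|row_label d B| :=
  enum_rank (urow (restrict (B (enum_val c).1) (enum_val c).2)).

Definition compat_prows : {set 'I_#|row_label d B|} :=
  [set r | if enum_val r is inl _ then true else false].

Lemma compat_matrixE r c :
  compat_matrix d B r c = (r == compat_pend c) || (r == compat_uend c) :> nat.
Proof.
rewrite mxE /compat_pend /compat_uend; case: (enum_val c) => i j /=.
by rewrite -!(can2_eq enum_valK enum_rankK).
Qed.

Lemma compat_pendP c : compat_pend c \in compat_prows.
Proof. by rewrite inE enum_rankK. Qed.

Lemma compat_uendP c : compat_uend c \notin compat_prows.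
Proof. by rewrite inE enum_rankK. Qed.

(** The graph has no parallel edges: the P-end determines j, and the tag of the U-end determines
    i. *)
Lemma compat_ends_inj c c' :
  compat_pend c = compat_pend c' -> compat_uend c = compat_uend c' -> c = c'.
Proof.
move=> /enum_rank_inj[eq_j] /enum_rank_inj[eq_i _]; apply: enum_val_inj.
by case: (enum_val c) (enum_val c') eq_i eq_j => i j [i' j'] /= -> ->.
Qed.

Lemma compat_monomial_param (R : comNzRingType) (P : state d -> R)
    (U : forall i : 'I_m, substate d (B i) -> R) :
  monomial_param (compat_matrix d B) (param_values P U) = compat_param P U.
Proof.
apply/funext => c; rewrite /monomial_param.
have pu : compat_uend c != compat_pend c.
  by rewrite eq_sym (neq_ab compat_pendP compat_uendP).
rewrite (bigD1 (compat_pend c)) //= (bigD1 (compat_uend c)) //=.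
rewrite !compat_matrixE !eqxx orbT /= !expr1 big1 ?mulr1 => [|r /andP[rp ru]].
  rewrite /param_values /compat_param /compat_pend /compat_uend !enum_rankK /=.
  by case: (enum_val c).
by rewrite compat_matrixE (negbTE rp) (negbTE ru) expr0.
Qed.

(** Every parameter vector indexed by rows comes from a pair (P, U), so vanishing for all t and
    vanishing for all (P, U) are the same condition. *)
Lemma param_values_surj (R : Type) (t : 'I_#|row_label d B| -> R) :
  exists P U, t = param_values P U.
Proof.
exists (fun j => t (enum_rank (prow B j))), (fun i b => t (enum_rank (urow b))).
apply/funext => r; rewrite /param_values -[LHS](congr1 t (enum_valK r)).
by case: (enum_val r) => [//|[i b]].
Qed.

End CompatMatrix.

Theorem theorem17 (R : realType) (n m : nat) (d : 'I_n -> nat)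
    (B : 'I_m -> {set 'I_n})
    (d_gt0 : forall k : 'I_n, (0 < d k)%N)
    (B_antichain : forall i i' : 'I_m, B i \subset B i' -> i = i') :
  [/\ graphical_unimodular (compat_matrix d B),
      forall (P : state d -> R) (U : forall i : 'I_m, substate d (B i) -> R),
        monomial_param (compat_matrix d B) (param_values P U)
          = compat_param P U,
      toric_ideal R (compat_matrix d B) = compat_ideal d B R
    & compat_ideal d B R
        = ideal_gen (induced_circuit_binomials R (compat_matrix d B))].
Proof.
have pend := @compat_pendP n m d B; have uend := @compat_uendP n m d B.
have AE := @compat_matrixE n m d B.
have toric_compat : toric_ideal R (compat_matrix d B) = compat_ideal d B R.
  apply/seteqP; split=> f.
    by move=> /toric_idealP f0 P U; rewrite -compat_monomial_param.
  move=> f0; apply/toric_idealP => t; have [P [U ->]] := param_values_surj t.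
  by rewrite compat_monomial_param.
split=> //.
- exact: bipartite_graphical_unimodular AE pend uend.
- exact: compat_monomial_param.
rewrite -toric_compat.
by apply: (toric_ideal_induced_circuits AE pend uend); apply: compat_ends_inj.
Qed.
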